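(* Let $p,r$ be real numbers. 1. The binomial sequence $\left\{\binom{np+r}{n}\right\}_{n=0}^{\infty}$ is positive definite if and only if either ($p\ge 1$ and $-1\le r\le p-1$) or ($p\le 0$ and $p-1\le r\le 0$). 2. The Raney sequence $\left\{\binom{np+r}{n}\frac{r}{np+r}\right\}_{n=0}^{\infty}$ is positive definite if and only if either ($p\ge 1$ and $0\le r\le p$) or ($p\le 0$ and $p-1\le r\le 0$) or else $r=0$.
   Context: For $a\in\mathbb{R}$ and $n\in\{0,1,2,\ldots\}$, $\binom{a}{n}:=a(a-1)\cdots(a-n+1)/n!$ (with $\binom{a}{0}=1$). The $n$-th term $\binom{np+r}{n}\frac{r}{np+r}$ of the Raney sequence is understood after cancelling the factor $np+r$: it equals $1$ for $n=0$ and $\frac{r}{n!}\prod_{i=1}^{n-1}(np+r-i)$ for $n\ge1$; in particular for $r=0$ the sequence is $(1,0,0,\ldots)$. A real sequence $\{s_n\}_{n=0}^\infty$ is called positive definite if $\sum_{i,j}s_{i+j}\alpha_i\alpha_j\ge0$ for every finitely supported real sequence $(\alpha_i)_{i\ge0}$; when $s_0=1$ this is equivalent to $\{s_n\}$ being the moment sequence of a probability measure on $\mathbb{R}$. *)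

(* Defs.v *)
From mathcomp Require Import all_boot all_order all_algebra.
From mathcomp Require Import reals.

Set Implicit Arguments.
Unset Strict Implicit.
Unset Printing Implicit Defensive.

Import Order.TTheory GRing.Theory Num.Theory.
Local Open Scope ring_scope.

Definition gbinom (R : realType) (a : R) (n : nat) : R :=
  (\prod_(i < n) (a - i%:R)) / n`!%:R.

Definition binomial_seq (R : realType) (p r : R) (n : nat) : R :=
  gbinom (n%:R * p + r) n.

(* The term binom(np+r, n) r/(np+r) after cancelling the factor np+r, so that
   it also makes sense when np+r = 0; see raney_seqE. *)
Definition raney_seq (R : realType) (p r : R) (n : nat) : R :=
  if n == 0%N then 1
  else r / n`!%:R * \prod_(1 <= i < n) (n%:R * p + r - i%:R).

(* alpha ranges over the finitely supported sequences, N over the bounds of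
   its support. *)
Definition positive_definite (R : realType) (s : nat -> R) : Prop :=
  forall (alpha : nat -> R) (N : nat),
    (forall i : nat, (N <= i)%N -> alpha i = 0) ->
    0 <= \sum_(i < N) \sum_(j < N) s (i + j)%N * alpha i * alpha j.

Lemma raney_seqE (R : realType) (p r : R) (n : nat) :
  n%:R * p + r != 0 ->
  raney_seq p r n = gbinom (n%:R * p + r) n * (r / (n%:R * p + r)).
Proof.
rewrite /raney_seq /gbinom; case: n => [|n] a0 /=.
  by move: a0; rewrite mul0r add0r big_ord0 fact0 divr1 mul1r => /divff.
rewrite big_ord_recl subr0 big_add1 big_mkord.
set a := (_ * p + r) in a0 *.
apply: (mulIf a0); rewrite -[RHS]mulrA divfK // [RHS]mulrC -!mulrA.
by congr (_ * _); rewrite [RHS]mulrA [RHS]mulrC [X in _ * X = _]mulrC.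
Qed.

(* Main.v *)
(* Positive definiteness is preserved by pointwise limits and by division by
   n e + f (e >= 0, f > 0), hence by multiplication by (n c + d) / (n e + f)
   whenever c f <= d e. The involution (p, r) |-> (1 - p, -1 - r) (resp.
   (1 - p, - r) for Raney) multiplies the n-th term by (-1)^n, so only p >= 1
   and 0 < p <= 1/2 matter.

   Sufficiency, p >= 1: the binomial sequence is a limit of products of such
   homographic factors, obtained by truncating the Gamma functions in
   Gamma(np + r + 1) / (Gamma(n + 1) Gamma(n(p - 1) + r + 1)); and the Raney
   term is binom(np + r - 1, n) r / (n(p - 1) + r).

   Necessity, 0 < p <= 1/2: the 2n-th term changes sign with the parity of the
   integer part of 2np + r, whereas even moments have to be positive.

   Necessity, p >= 1: multiplying by the positive definite sequence of Beta
   values B(n + m + 1, n(p - 1) + y), which is essentially the reciprocal of a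
   binomial sequence, leaves a rational function of n, which can be turned into
   (n e + f) / (n p + q)^3 with f / e < q / p. This is not positive definite:
   its even-order finite differences at 0 are eventually negative, since the
   harmonic series diverges. *)
Require Import Defs.
From mathcomp Require Import all_boot all_order all_algebra.
From mathcomp Require Import reals topology normedtype sequences ring lra zify.

Set Implicit Arguments.
Unset Strict Implicit.
Unset Printing Implicit Defensive.

Import Order.TTheory GRing.Theory Num.Theory.
Import numFieldNormedType.Exports.
Local Open Scope classical_set_scope.
Local Open Scope ring_scope.

(** * Positive semidefinite kernels *)

(** An arbitrary finite index type allows kernels indexed by pairs, which [psd_marginal]
    contracts. *)
Definition psd (R : realType) (I : finType) (k : I -> I -> R) : Prop :=
  forall a : I -> R, 0 <= \sum_i \sum_j k i j * a i * a j.

Section Psd.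
Variables (R : realType) (I : finType).
Implicit Types k l : I -> I -> R.

Lemma eq_psd k l : k =2 l -> psd k -> psd l.
Proof.
move=> kl pk a; rewrite (eq_bigr (fun i => \sum_j k i j * a i * a j)) //.
by move=> i _; apply: eq_bigr => j _; rewrite kl.
Qed.

Lemma psdD k l : psd k -> psd l -> psd (fun i j => k i j + l i j).
Proof.
move=> pk pl a; have := addr_ge0 (pk a) (pl a).
rewrite -big_split /=; under eq_bigr => i _ do rewrite -big_split /=.
congr (0 <= _); apply: eq_bigr => i _; apply: eq_bigr => j _; ring.
Qed.

Lemma psd_scale k (c : I -> R) :
  psd k -> psd (fun i j => k i j * c i * c j).
Proof.
move=> pk a; have := pk (fun i => c i * a i); congr (0 <= _).
by apply: eq_bigr => i _; apply: eq_bigr => j _; ring.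
Qed.

(** The form of the pulled-back kernel at [a] is that of [k] at the sums of [a] over the fibres of
    [f]. *)
Lemma psd_pullback (J : finType) k (f : J -> I) :
  psd k -> psd (fun x y => k (f x) (f y)).
Proof.
move=> pk a; have := pk (fun i => \sum_(x | f x == i) a x); congr (0 <= _).
rewrite [RHS](partition_big f predT) //=; apply: eq_bigr => i _.
rewrite exchange_big (partition_big f predT) //=; apply: eq_bigr => j _.
rewrite mulr_sumr; apply: eq_bigr => y /eqP fy.
by rewrite mulr_sumr mulr_suml; apply: eq_bigr => x /eqP fx; rewrite fx fy.
Qed.

Lemma psd_marginal (J : finType) (k : I * J -> I * J -> R) (c : I -> J -> R) :
  psd k ->
  psd (fun i i' => \sum_j \sum_j' k (i, j) (i', j') * c i j * c i' j').
Proof.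
move=> pk a; have := pk (fun x => c x.1 x.2 * a x.1); congr (0 <= _).
transitivity (\sum_i \sum_j \sum_i' \sum_j'
    k (i, j) (i', j') * (c i j * a i) * (c i' j' * a i')).
  rewrite [RHS]pair_bigA; apply: eq_bigr => -[i j] _ /=.
  by rewrite [RHS]pair_bigA; apply: eq_bigr => -[i' j'] _.
apply: eq_bigr => i _; rewrite exchange_big; apply: eq_bigr => i' _.
rewrite 2!mulr_suml; apply: eq_bigr => j _; rewrite 2!mulr_suml.
by apply: eq_bigr => j' _; ring.
Qed.

Lemma psd_lim (k_ : nat -> I -> I -> R) k :
  (forall n, psd (k_ n)) ->
  (forall i j, k_ n i j @[n --> \oo] --> k i j) -> psd k.
Proof.
move=> pk kk a; apply: (@cvgr_to_ge _ \oo _ _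
  (fun n => \sum_i \sum_j k_ n i j * a i * a j)); last first.
  by near=> n; apply: pk.
apply: cvg_big => [|i _]; first exact: add_continuous.
apply: cvg_big => [|j _]; first exact: add_continuous.
by apply: cvgM; [apply: cvgM => //|]; exact: cvg_cst.
Unshelve. all: by end_near.
Qed.

(* Cayley transform: with u = (1 - x) / (1 + x), the kernel 1 / (x_i + x_j) is
   2 / ((1 + x_i) (1 + x_j)) times the geometric series in u_i u_j. *)
Lemma psd_cauchy k (x : I -> R) :
  (forall i, 0 < x i) -> psd k -> psd (fun i j => k i j / (x i + x j)).
Proof.
move=> x0 pk; pose u i : R := (1 - x i) / (1 + x i).
have xx i j : x i + x j != 0 by rewrite gt_eqF // addr_gt0.
have x1 i : 1 + x i != 0 by rewrite gt_eqF // addr_gt0.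
apply: (@psd_lim (fun n i j => k i j * (1 - (u i * u j) ^+ n) / (x i + x j))).
  elim=> [|n IH].
    by move=> a; rewrite big1 // => i _; rewrite big1 // => j _;
      rewrite expr0 subrr mulr0 !mul0r.
  pose k2 i j := k i j * (u i ^+ n / (1 + x i)) * (u j ^+ n / (1 + x j)).
  have pk2 : psd k2 by exact: psd_scale.
  (* The next term of the geometric series is twice [k2], hence the two copies. *)
  apply: eq_psd (psdD (psdD pk2 pk2) IH) => i j.
  rewrite /k2 exprS !(exprMn n (u i) (u j)).
  move: (u i ^+ n) (u j ^+ n) => a b; rewrite /u.
  by field; rewrite xx !x1.
move=> i j; suff : k i j * (1 - (u i * u j) ^+ n) / (x i + x j)
    @[n --> \oo] --> k i j * (1 - 0) / (x i + x j) by rewrite subr0 mulr1.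
have u1 m : `|u m| < 1.
  have xm := x0 m; rewrite ltr_norml /u ltr_pdivlMr ?ltr_pdivrMr; lra.
apply: cvgM; last exact: cvg_cst.
apply: cvgM; first exact: cvg_cst.
apply: cvgB; first exact: cvg_cst.
by apply: cvg_expr; rewrite normrM -[ltRHS]mulr1 ltr_pM.
Qed.

End Psd.

(** * Positive definite sequences *)

Section PositiveDefinite.
Variable R : realType.
Implicit Types s t : nat -> R.

Lemma pdP s :
  positive_definite s <-> forall N, psd (fun i j : 'I_N => s (i + j)%N).
Proof.
split=> [ps N a|ps a N _]; last exact: (ps N (fun i => a i)).
(* The vector [a] is extended by 0 beyond [N]. *)
have := ps (fun n => oapp a 0 (insub n)) N; rewrite /=.
have aN i : (N <= i)%N -> oapp a 0 (insub i : option 'I_N) = 0.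
  by move=> Ni; rewrite insubN // -leqNgt.
move=> /(_ aN); congr (0 <= _).
by apply: eq_bigr => i _; apply: eq_bigr => j _; rewrite !valK.
Qed.

Lemma eq_pd s t : s =1 t -> positive_definite s -> positive_definite t.
Proof.
by move=> st /pdP ps; apply/pdP => N; apply: eq_psd (ps N) => i j.
Qed.

Lemma pdD s t : positive_definite s -> positive_definite t ->
  positive_definite (fun n => s n + t n).
Proof. by move=> /pdP ps /pdP pt; apply/pdP => N; apply: psdD. Qed.

Lemma pd_geom s (x : R) : positive_definite s ->
  positive_definite (fun n => s n * x ^+ n).
Proof.
move=> /pdP ps; apply/pdP => N.
apply: eq_psd (psd_scale (fun i : 'I_N => x ^+ i) (ps N)) => i j.
by rewrite exprD mulrA.
Qed.

Lemma pdZ s (c : R) : 0 <= c -> positive_definite s ->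
  positive_definite (fun n => s n * c).
Proof.
move=> c0 /pdP ps; apply/pdP => N.
apply: eq_psd (psd_scale (fun _ : 'I_N => Num.sqrt c) (ps N)) => i j.
by rewrite -mulrA -expr2 sqr_sqrtr.
Qed.

Lemma pd_cst1 : positive_definite (fun=> 1 : R).
Proof.
apply/pdP => N a; rewrite (_ : \sum_i _ = (\sum_i a i) ^+ 2) ?sqr_ge0 //.
rewrite expr2 mulr_suml; apply: eq_bigr => i _; rewrite mulr_sumr.
by apply: eq_bigr => j _; rewrite mul1r.
Qed.

Lemma pd_dirac0 : positive_definite (fun n => (n == 0)%:R : R).
Proof. by apply: eq_pd (pd_geom 0 pd_cst1) => n; rewrite mul1r expr0n. Qed.

Lemma pd_lim (s_ : nat -> nat -> R) s :
  (forall m, positive_definite (s_ m)) ->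
  (forall n, s_ m n @[m --> \oo] --> s n) -> positive_definite s.
Proof.
move=> ps ss; apply/pdP => N.
apply: (psd_lim (k_ := fun m (i j : 'I_N) => s_ m (i + j)%N)).
  by move=> m; move/pdP : (ps m).
by move=> i j; exact: ss.
Qed.

Lemma pd_shift s k : positive_definite s ->
  positive_definite (fun n => s (n + k.*2)%N).
Proof.
move=> /pdP ps; apply/pdP => N.
apply: eq_psd (psd_pullback (@rshift k N) (ps (k + N)%N)) => i j /=.
by congr s; lia.
Qed.

Lemma pd_div s (e f : R) : 0 <= e -> 0 < f -> positive_definite s ->
  positive_definite (fun n => s n / (n%:R * e + f)).
Proof.
move=> e0 f0 /pdP ps; apply/pdP => N.
(* Splitting [f] evenly between the two indices makes the Cauchy denominator depend on [i + j]
   only. *)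
have x0 (i : 'I_N) : 0 < i%:R * e + f / 2.
  by rewrite ltr_wpDl ?mulr_ge0 ?divr_gt0.
apply: eq_psd (psd_cauchy x0 (ps N)) => i j.
by congr (_ / _); rewrite natrD; field.
Qed.

(** Partial fractions: the factor equals [c / e + (d - c / e * f) / (n%:R * e + f)], with both
    coefficients nonnegative. *)
Lemma pd_homographic s (c d e f : R) :
  0 <= c -> 0 < e -> 0 < f -> c * f <= d * e -> positive_definite s ->
  positive_definite (fun n => s n * (n%:R * c + d) / (n%:R * e + f)).
Proof.
move=> c0 e0 f0 cd ps.
have ce0 : 0 <= c / e by rewrite divr_ge0 // ltW.
have de0 : 0 <= d - c / e * f by rewrite subr_ge0 mulrAC ler_pdivrMr.
apply: eq_pd (pdD (pdZ ce0 ps) (pdZ de0 (pd_div (ltW e0) f0 ps))) => n.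
have nef : n%:R * e + f != 0 by rewrite gt_eqF // ltr_wpDl // mulr_ge0 // ltW.
by field; rewrite nef gt_eqF.
Qed.

Lemma pd_cauchy_schwarz s i j : positive_definite s ->
  s (i + j)%N ^+ 2 <= s i.*2 * s j.*2.
Proof.
case: (eqVneq i j) => [->|ij] ps; first by rewrite addnn expr2.
have q x y : 0 <= s i.*2 * x ^+ 2 + s (i + j)%N * x * y *+ 2 + s j.*2 * y ^+ 2.
  pose a n : R := if n == i then x else if n == j then y else 0.
  have := ps a (i + j).+1; set lhs := (\sum_(_ < _) _).
  suff -> : lhs = s i.*2 * x ^+ 2 + s (i + j)%N * x * y *+ 2 + s j.*2 * y ^+ 2.
    by apply=> n ijn; rewrite /a !ifF //; lia.
  have il : (i < (i + j).+1)%N by lia.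
  have jl : (j < (i + j).+1)%N by lia.
  have ji : Ordinal jl != Ordinal il by rewrite -val_eqE /= eq_sym.
  have sumE F : \sum_(m < (i + j).+1) F m * a m =
      F (Ordinal il) * x + F (Ordinal jl) * y.
    rewrite (bigD1 (Ordinal il)) //= (bigD1 (Ordinal jl)) //= /a eqxx.
    rewrite eq_sym (negbTE ij) eqxx addrA big1 ?addr0 // => m.
    by rewrite -!val_eqE /= => /andP[/negbTE -> /negbTE ->]; rewrite mulr0.
  rewrite /lhs; under eq_bigr => m _.
    rewrite sumE mulrAC [X in _ + X]mulrAC -mulrDl; over.
  rewrite sumE /= !addnn (addnC j i); ring.
have [sj0|sj0] := eqVneq (s j.*2) 0.
  (* With [s j.*2 = 0] the form is affine in [y]; this point gives it the value
     [- s (i + j) ^+ 2]. *)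
  by have := q (- s (i + j)%N) ((s i.*2 + 1) / 2); rewrite sj0; lra.
have sj : 0 < s j.*2 by rewrite lt_def sj0; have := q 0 1; lra.
by rewrite -(ler_pM2l sj); have := q (s j.*2) (- s (i + j)%N); lra.
Qed.

Lemma pd_even_ge0 s n : positive_definite s -> 0 <= s n.*2.
Proof.
move=> /(pd_shift n)/pdP/(_ 1%N (fun=> 1)).
by rewrite !big_ord1 !mulr1 add0n.
Qed.

(* A vanishing even moment of positive order would make all of them vanish. *)
Lemma pd_even_gt0 s n : positive_definite s -> 0 < s 2 -> (0 < n)%N ->
  0 < s n.*2.
Proof.
move=> ps s2; case: n => // n _; elim: n => [//|n IH].
rewrite lt_def pd_even_ge0 // andbT; apply/eqP => s0.
have := pd_cauchy_schwarz n n.+2 ps.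
by rewrite s0 mulr0 leNgt exprn_gt0 // addnS -addSn addnn.
Qed.

End PositiveDefinite.

(** * Finite differences and the Beta function *)

Section FiniteDifference.
Variable R : realType.
Implicit Types (g s : nat -> R) (x y z : R).

(** With this sign, the difference of order [k] of [t ^+ n] is [t ^+ n * (1 - t) ^+ k]. *)
Fixpoint fdiff k g (n : nat) : R :=
  if k is k'.+1 then fdiff k' g n - fdiff k' g n.+1 else g n.

Lemma eq_fdiff k g g' n : g =1 g' -> fdiff k g n = fdiff k g' n.
Proof. by move=> gg; elim: k n => [|k IH] n //=; rewrite !IH. Qed.

Lemma fdiffD k l g n : fdiff (k + l) g n = fdiff k (fdiff l g) n.
Proof. by elim: k n => [|k IH] n //=; rewrite !IH. Qed.

(** The binomial coefficients vanish beyond [k], so differences of several orders can share one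
    range [N]. *)
Lemma fdiffE N k g n : (k < N)%N ->
  fdiff k g n = \sum_(j < N) (-1) ^+ j * 'C(k, j)%:R * g (n + j)%N.
Proof.
elim: k N n => [|k IH] [|N] n // kN.
  rewrite big_ord_recl /= bin0 mul1r mul1r addn0 big1 ?addr0 // => j _.
  by rewrite bin0n mulr0 mul0r.
rewrite /= (IH N.+1) 1?ltnW // (IH N) // 2!big_ord_recl /= !bin0 -addrA.
congr (_ + _); rewrite -sumrB; apply: eq_bigr => j _.
by rewrite /bump /= add1n binS natrD addSnnS exprS; ring.
Qed.

Lemma fdiff_lin k g g' c c' n :
  fdiff k (fun j => c * g j + c' * g' j) n =
  c * fdiff k g n + c' * fdiff k g' n.
Proof. by elim: k n => [|k IH] n //=; rewrite !IH; ring. Qed.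

(** For moments this is the integral of [(1 - t) ^+ n.*2]; the test vector lists the coefficients of
    [(1 - t) ^+ n]. *)
Lemma pd_fdiff_ge0 s n : positive_definite s -> 0 <= fdiff n.*2 s 0.
Proof.
move=> /pdP/(_ n.+1)/(_ (fun i => (-1) ^+ i * 'C(n, i)%:R)).
rewrite -addnn fdiffD (fdiffE _ _ (ltnSn n)); congr (0 <= _).
apply: eq_bigr => i _; rewrite (fdiffE _ _ (ltnSn n)) mulr_sumr.
by apply: eq_bigr => j _; ring.
Qed.

(* The value B(k + 1, z) of the Beta function. *)
Definition beta_nat k z : R := k`!%:R / \prod_(i < k.+1) (z + i%:R).

Lemma prod_shift_gt0 k z : 0 < z -> 0 < \prod_(i < k) (z + i%:R).
Proof. by move=> z0; apply: prodr_gt0 => i _; rewrite ltr_wpDr. Qed.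

Lemma beta_nat_gt0 k z : 0 < z -> 0 < beta_nat k z.
Proof. by move=> z0; rewrite divr_gt0 ?prod_shift_gt0 // ltr0n fact_gt0. Qed.

Lemma beta_natS k z : 0 < z ->
  beta_nat k.+1 z = beta_nat k z * (k.+1%:R / (z + k.+1%:R)).
Proof.
move=> z0; rewrite /beta_nat [in LHS]big_ord_recr factS natrM /=.
by rewrite [RHS]mulf_div [X in X / _ = _]mulrC.
Qed.

Lemma beta_nat_shift k z : 0 < z ->
  beta_nat k (z + 1) = beta_nat k z * (z / (z + k.+1%:R)).
Proof.
move=> z0; have e : z * \prod_(i < k.+1) (z + 1 + i%:R) =
         \prod_(i < k.+1) (z + i%:R) * (z + k.+1%:R).
  rewrite -[RHS](big_ord_recr k.+1 (fun i : 'I_k.+2 => z + i%:R)).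
  rewrite [RHS]big_ord_recl /= addr0.
  by congr (_ * _); apply: eq_bigr => i _; rewrite -addrA -[1 + _]mulrS.
rewrite /beta_nat -mulrA; congr (_ * _).
move/(canRL (mulKf (lt0r_neq0 z0))): e => ->.
by rewrite 2!invfM invrK mulrC mulrAC -mulrA.
Qed.

Lemma beta_natB k z : 0 < z ->
  beta_nat k z - beta_nat k (z + 1) = beta_nat k.+1 z.
Proof.
move=> z0; rewrite beta_natS // beta_nat_shift //.
have : z + k.+1%:R != 0 by rewrite gt_eqF // ltr_wpDr.
by move: k.+1%:R => c zc; field.
Qed.

Lemma fdiff_beta k m z n : 0 < z ->
  fdiff k (fun j => beta_nat m (z + j%:R)) n = beta_nat (k + m) (z + n%:R).
Proof.
move=> z0; elim: k n => [|k IH] n //=.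
by rewrite !IH mulrSr addrA beta_natB // ltr_wpDr.
Qed.

(** Each factor of the denominator is a sum [(x i + l / 2) + (x j + l / 2)], so [psd_cauchy] applies
    once per factor. *)
Lemma psd_beta (I : finType) (k : I -> I -> R) (x : I -> R) m :
  (forall i, 0 < x i) -> psd k ->
  psd (fun i j => k i j * beta_nat m (x i + x j)).
Proof.
move=> x0 pk.
have pm n : psd (fun i j => k i j / \prod_(l < n) (x i + x j + l%:R)).
  elim: n => [|n IH]; first by apply: eq_psd pk => i j; rewrite big_ord0 divr1.
  have xn i : 0 < x i + n%:R / 2 by rewrite ltr_wpDr ?divr_ge0.
  apply: eq_psd (psd_cauchy xn IH) => i j.
  by rewrite big_ord_recr /= invfM mulrA; congr (_ / _); field.
apply: eq_psd (psd_scale (fun=> Num.sqrt m`!%:R) (pm m.+1)) => i j.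
by rewrite -mulrA -expr2 sqr_sqrtr // /beta_nat mulrA mulrAC.
Qed.

(* Expand both factors (1 - t)^a and (1 - t)^b of the integrand of
   B(a + b + m + 1, z_a + z_b) to get a combination of kernels as in
   [psd_beta]. *)
Lemma pd_beta s e y m : 0 <= e -> 0 < y -> positive_definite s ->
  positive_definite (fun n => s n * beta_nat (n + m) (n%:R * e + y)).
Proof.
move=> e0 y0 /pdP ps; apply/pdP => N.
(* A pair holds an index of the sequence and the exponent of [t] in the expansion of
   [(1 - t) ^+ u.1]. *)
pose x (u : 'I_N * 'I_N) : R := u.1%:R * e + y / 2 + u.2%:R.
have x0 u : 0 < x u by rewrite /x ltr_wpDr // ltr_wpDl ?divr_gt0 ?mulr_ge0.
have := psd_beta m x0 (psd_pullback (fun u : 'I_N * 'I_N => u.1) (ps N)).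
pose c (i j : 'I_N) : R := (-1) ^+ j * 'C(i, j)%:R.
move/(psd_marginal c); apply: eq_psd => a b.
have z0 : 0 < (a + b)%:R * e + y by rewrite ltr_wpDl ?mulr_ge0.
have := fdiff_beta (a + b) m 0 z0; rewrite addr0 => <-.
rewrite fdiffD (fdiffE _ _ (ltn_ord a)) mulr_sumr; apply: eq_bigr => i _.
rewrite (fdiffE _ _ (ltn_ord b)) 2!mulr_sumr; apply: eq_bigr => j _ /=.
rewrite (_ : x (a, i) + x (b, j) = (a + b)%:R * e + y + (0 + i + j)%:R).
  by rewrite /c; ring.
by rewrite /x /= !natrD; field.
Qed.

(** The differences of [1 / z] are Beta values; this is minus their derivative in [z], obtained from
    the logarithmic derivative. *)
Lemma fdiff_inv2 M z n : 0 < z ->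
  fdiff M (fun j => (z + j%:R) ^- 2) n =
  beta_nat M (z + n%:R) * \sum_(i < M.+1) (z + n%:R + i%:R)^-1.
Proof.
move=> z0; elim: M n => [|M IH] n.
  by rewrite /beta_nat !big_ord1 fact0 addr0 div1r -expr2 exprVn.
have x0 : 0 < z + n%:R by rewrite ltr_wpDr.
rewrite /= !IH (mulrSr 1 n) addrA; move: (z + n%:R) x0 => x x0.
have : x^-1 + \sum_(i < M.+1) (x + 1 + i%:R)^-1 = \sum_(i < M.+2) (x + i%:R)^-1.
  rewrite [RHS]big_ord_recl /= addr0; congr (_ + _); apply: eq_bigr => i _.
  by rewrite -addrA -[1 + _]mulrS.
move/(canRL (addKr _)) ->.
rewrite !(big_ord_recr M.+1) /= beta_natS // beta_nat_shift //.
have : x + M.+1%:R != 0 by rewrite gt_eqF // ltr_wpDr.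
by move: M.+1%:R => c xc; field; rewrite xc gt_eqF.
Qed.

(** Half the second derivative of the same identity for [1 / z]. *)
Lemma fdiff_inv3 M z n : 0 < z ->
  fdiff M (fun j => (z + j%:R) ^- 3) n =
  beta_nat M (z + n%:R) * ((\sum_(i < M.+1) (z + n%:R + i%:R)^-1) ^+ 2 +
                           \sum_(i < M.+1) (z + n%:R + i%:R) ^- 2) / 2.
Proof.
move=> z0; elim: M n => [|M IH] n.
  have x0 : 0 < z + n%:R by rewrite ltr_wpDr.
  by rewrite /beta_nat !big_ord1 fact0 addr0 /=; field; rewrite gt_eqF.
have x0 : 0 < z + n%:R by rewrite ltr_wpDr.
rewrite /= !IH (mulrSr 1 n) addrA; move: (z + n%:R) x0 => x x0.
have : x^-1 + \sum_(i < M.+1) (x + 1 + i%:R)^-1 = \sum_(i < M.+2) (x + i%:R)^-1.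
  rewrite [RHS]big_ord_recl /= addr0; congr (_ + _); apply: eq_bigr => i _.
  by rewrite -addrA -[1 + _]mulrS.
move/(canRL (addKr _)) ->.
have : x^-2 + \sum_(i < M.+1) (x + 1 + i%:R)^-2 = \sum_(i < M.+2) (x + i%:R)^-2.
  rewrite [RHS]big_ord_recl /= addr0; congr (_ + _); apply: eq_bigr => i _.
  by rewrite -addrA -[1 + _]mulrS.
move/(canRL (addKr _)) ->.
rewrite !(big_ord_recr M.+1) /= beta_natS // beta_nat_shift //.
have : x + M.+1%:R != 0 by rewrite gt_eqF // ltr_wpDr.
by move: M.+1%:R => c xc; field; rewrite xc gt_eqF.
Qed.

(** The count [n.*2.+1] is the number of terms that a difference of order [n.*2] produces in
    [fdiff_inv2]. *)
Lemma harmonic_unbounded z (C : R) : 0 < z ->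
  exists n, C < \sum_(i < n.*2.+1) (z + i%:R)^-1.
Proof.
move=> z0; pose h n : R := \sum_(i < n) (z + i%:R)^-1.
have hD n m : h n + m%:R / (z + (n + m)%:R) <= h (n + m)%N.
  elim: m => [|m IH]; first by rewrite mul0r addr0 addn0.
  have d0 k : 0 < z + k%:R by rewrite ltr_wpDr.
  rewrite addnS [leRHS]big_ord_recr /= -/(h _); move: IH.
  suff : m.+1%:R / (z + (n + m).+1%:R) <=
         m%:R / (z + (n + m)%:R) + (z + (n + m)%:R)^-1 by lra.
  rewrite -[X in _ <= _ + X]mul1r -mulrDl -mulrSr ler_pM2l ?ltr0n //.
  by rewrite lef_pV2 ?posrE // lerD2l ler_nat.
have hk k : exists n, k%:R / 2 <= h n.
  elim: k => [|k [n IH]]; first by exists 0%N; rewrite mul0r /h big_ord0.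
  (* For [m >= z + n], the next [m] terms add at least [m / (z + n + m) >= 1 / 2]. *)
  have [m zm] : exists m, z + n%:R <= m%:R :> R.
    by exists (Num.truncn (z + n%:R)).+1; rewrite ltW // truncnS_gt.
  exists (n + m)%N; apply: le_trans (hD n m); rewrite mulrSr mulrDl lerD //.
  have zn : 0 < z + n%:R by rewrite ltr_wpDr.
  rewrite ler_pdivlMr natrD ?addrA; lra.
have [n] := hk (Num.truncn (C * 2)).+1; have := truncnS_gt (C * 2).
move=> C2 hn; exists n; apply: lt_le_trans (_ : h n <= _); first by lra.
rewrite -/(h _) -[leLHS]addr0 (_ : n.*2.+1 = n + n.+1)%N; last by lia.
apply: le_trans (hD n n.+1).
by rewrite lerD2l divr_ge0 // addr_ge0 // ltW.
Qed.

Lemma not_pd_cubic (e f p q : R) : 0 < p -> 0 < q -> f * p < e * q ->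
  ~ positive_definite (fun n => (n%:R * e + f) / (n%:R * p + q) ^+ 3).
Proof.
move=> p0 q0 fe ps; pose a := q / p; have a0 : 0 < a by rewrite divr_gt0.
pose g := e * a - f; have g0 : 0 < g by rewrite subr_gt0 mulrA ltr_pdivlMr.
(* Since [n e + f = e (a p + n p) / p - g], the difference is a positive multiple of
   [e * h - g * (h ^+ 2 + k) / 2], negative once [h > 2 * e / g]. *)
have [n hn] := harmonic_unbounded (2 * e / g) a0.
have := pd_fdiff_ge0 n ps.
have sE j : (j%:R * e + f) / (j%:R * p + q) ^+ 3 =
    e / p ^+ 3 * (a + j%:R) ^- 2 + (- g / p ^+ 3) * (a + j%:R) ^- 3.
  have aj : 0 < a + j%:R by rewrite ltr_wpDr.
  have -> : q = a * p by rewrite divfK // gt_eqF.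
  rewrite -mulrDl addrC /g; field.
  by rewrite !gt_eqF // addrC.
rewrite (eq_fdiff _ _ sE) fdiff_lin fdiff_inv2 // fdiff_inv3 // addr0.
set h := \sum_(i < _) _ in hn *; set b := beta_nat _ _; set k := \sum_(i < _) _.
have b0 : 0 < b by exact: beta_nat_gt0.
have k0 : 0 <= k.
  by apply: sumr_ge0 => i _; rewrite invr_ge0 exprn_ge0 // addr_ge0 // ltW.
have h0 : 0 < h.
  rewrite /h big_ord_recl ltr_wpDr ?invr_gt0 ?addr0 //.
  by apply: sumr_ge0 => i _; rewrite invr_ge0 addr_ge0 // ltW.
have : e * h - g * (h ^+ 2 + k) / 2 < 0.
  have : 2 * e < h * g by rewrite -ltr_pdivrMr.
  rewrite -subr_gt0 => /(mulr_gt0 h0); have := mulr_ge0 (ltW g0) k0; lra.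
have pb : 0 < b / p ^+ 3 by rewrite divr_gt0 // exprn_gt0.
move=> lt0; rewrite leNgt (_ : _ + _ =
    b / p ^+ 3 * (e * h - g * (h ^+ 2 + k) / 2)).
  by rewrite pmulr_rlt0 // lt0.
by field; rewrite gt_eqF.
Qed.

End FiniteDifference.

(** * Binomial and Raney sequences *)

Section BinomialRaney.
Variable R : realType.
Implicit Types (p r : R).

(** Reversing the product exhibits Gamma(np + r + 1) / Gamma(n(p - 1) + r + 1), whose factors are
    positive for [p >= 1] and [r > -1]. *)
Lemma binomial_seqE p r n :
  binomial_seq p r n = (\prod_(i < n) (n%:R * (p - 1) + r + i.+1%:R)) / n`!%:R.
Proof.
rewrite /binomial_seq /gbinom; congr (_ / _).
rewrite (reindex_inj rev_ord_inj) /=; apply: eq_bigr => i _.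
by rewrite natrB //; ring.
Qed.

Lemma raney_binomial p r n : n%:R * (p - 1) + r != 0 ->
  raney_seq p r n = binomial_seq p (r - 1) n * (r / (n%:R * (p - 1) + r)).
Proof.
rewrite /raney_seq /binomial_seq /gbinom; case: n => [|n] nz /=.
  by move: nz; rewrite big_ord0 fact0 divr1 mul1r !mul0r !add0r => /divff.
rewrite big_ord_recr /= big_add1 big_mkord.
rewrite (eq_bigr (fun i : 'I_n => n.+1%:R * p + (r - 1) - i%:R)); last first.
  by move=> i _; rewrite mulrSr; ring.
have -> : n.+1%:R * p + (r - 1) - n%:R = n.+1%:R * (p - 1) + r.
  by rewrite mulrSr; ring.
have f0 : n.+1`!%:R != 0 :> R by rewrite pnatr_eq0 -lt0n fact_gt0.
move: f0 nz; move: (\prod_(_ < _) _) (n.+1`!)%:R (n.+1%:R * (p - 1) + r).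
by move=> a b c b0 c0; field; rewrite c0.
Qed.

Lemma binomial_seq_reflect p r n :
  binomial_seq (1 - p) (-1 - r) n = binomial_seq p r n * (-1) ^+ n.
Proof.
rewrite [in RHS]binomial_seqE mulrAC; congr (_ / _).
rewrite mulrC -[X in _ ^+ X]card_ord -prodr_const -big_split.
by apply: eq_bigr => i _ /=; rewrite mulrSr; ring.
Qed.

Lemma raney_seq_reflect p r n :
  raney_seq (1 - p) (- r) n = raney_seq p r n * (-1) ^+ n.
Proof.
rewrite /raney_seq; case: n => [|n] /=; first by rewrite mulr1.
rewrite [in LHS]big_nat_rev [in RHS]big_nat_cond [in LHS]big_nat_cond.
rewrite (eq_bigr (fun i : nat => (-1) * (n.+1%:R * p + r - i%:R))); last first.
  by move=> i /andP[/andP[_ ni] _]; rewrite subSS natrB 1?ltnW //; ring.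
rewrite -2!big_nat_cond big_split /= prodr_const_nat subSS subn0 exprS.
by ring.
Qed.

Lemma pd_binomial_reflect p r : positive_definite (binomial_seq p r) ->
  positive_definite (binomial_seq (1 - p) (-1 - r)).
Proof.
by move/(pd_geom (-1)); apply: eq_pd => n; rewrite binomial_seq_reflect.
Qed.

Lemma pd_raney_reflect p r : positive_definite (raney_seq p r) ->
  positive_definite (raney_seq (1 - p) (- r)).
Proof.
by move/(pd_geom (-1)); apply: eq_pd => n; rewrite raney_seq_reflect.
Qed.

(** * Sufficiency for [p >= 1] *)

Lemma cvg_prod_shift k (c : nat -> R) :
  \prod_(i < k) (1 + c i / m.+1%:R) @[m --> \oo] --> (1 : R).
Proof.
suff : \prod_(i < k) (1 + c i / m.+1%:R) @[m --> \oo] -->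
    \prod_(i < k) (1 : R) by rewrite big1_eq.
apply: cvg_big => [|i _]; first exact: mul_continuous.
suff : 1 + c i * m.+1%:R^-1 @[m --> \oo] --> 1 + c i * 0 by rewrite mulr0 addr0.
apply: cvgD; first exact: cvg_cst.
by apply: cvgM; [exact: cvg_cst|exact: cvg_harmonic].
Qed.

Lemma natr_fact_addn m n :
  (m + n)`!%:R = m`!%:R * \prod_(i < n) (m%:R + i.+1%:R) :> R.
Proof.
elim: n => [|n IH]; first by rewrite addn0 big_ord0 mulr1.
by rewrite addnS factS natrM IH big_ord_recr /= -addnS natrD; ring.
Qed.

(** Each 1 / Gamma(x + 1) in the Gamma quotient is replaced by finitely many factors [x + i.+1]: [a]
    and [b] of them for the Gammas of the denominator, [a + b] for that of the numerator. *)
Definition partial_ratio p r (a b n : nat) : R :=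
  (\prod_(i < a) (n%:R + i.+1%:R)) *
  (\prod_(i < b) (n%:R * (p - 1) + r + i.+1%:R)) /
  \prod_(i < a + b) (n%:R * p + r + i.+1%:R).

(* The last factor removed from the numerator is the one with the smaller
   zero (the farther from 0): this zero is at most -(r + a + b) / p, the
   smallest pole, because the latter is the mediant of -a / 1 and
   -(r + b) / (p - 1). *)
Lemma pd_partial_ratio p r a b : 1 <= p -> -1 < r -> r <= p - 1 ->
  positive_definite (partial_ratio p r a b).
Proof.
move=> p1 r1 rp; move En : (a + b)%N => n.
elim: n a b En => [|n IH] a b En.
  have [-> ->] : a = 0%N /\ b = 0%N by lia.
  apply: eq_pd (@pd_cst1 R) => n.
  by rewrite /partial_ratio !big_ord0 mulr1 divr1.
have f0 : 0 < r + n.+1%:R.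
  by rewrite mulrSr; have : 0 <= n%:R :> R by []; lra.
have p0 : 0 < p by lra.
have pr0 : 0 <= p - 1 by lra.
have EnR : n.+1%:R = a%:R + b%:R :> R by rewrite -En natrD.
have [/andP[a0 rab]|] := boolP ((0 < a)%N && (r + b%:R <= (p - 1) * a%:R)).
  case: a En a0 rab EnR => // a En _ rab EnR.
  have := @pd_homographic _ _ 1 a.+1%:R p (r + n.+1%:R) ler01 p0 f0 _
    (IH a b _).
  have -> : 1 * (r + n.+1%:R) <= a.+1%:R * p by rewrite EnR; lra.
  move=> /(_ isT); have [En'] : (a + b = n)%N by lia.
  move=> /(_ En'); apply: eq_pd => m.
  rewrite /partial_ratio addSn !big_ord_recr /=.
  by rewrite En' mulr1 addrA invfM; ring.
rewrite negb_and -ltNge -leqNgt leqn0 => ab.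
have rab : (p - 1) * a%:R <= r + b%:R.
  case/orP: ab => [/eqP a0|/ltW //].
  by move: EnR f0; rewrite a0 mulr0 => ->; rewrite add0r => /ltW.
(* If [b = 0], then [a > 0] and [r <= p - 1 <= (p - 1) * a], so the first case would have
   applied. *)
have b0 : (0 < b)%N.
  rewrite lt0n; apply/eqP => b0; case/orP: ab => [/eqP a0|].
    by move: En; rewrite a0 b0.
  move: En; rewrite b0 addn0 addr0 => ->; rewrite ltNge => /negP[].
  by apply: le_trans rp _; rewrite ler_peMr // ler1n.
case: b En b0 rab EnR {ab} => // b En _ rab EnR.
have := @pd_homographic _ _ (p - 1) (r + b.+1%:R) p (r + n.+1%:R)
  pr0 p0 f0 _ (IH a b _).
have -> : (p - 1) * (r + n.+1%:R) <= (r + b.+1%:R) * p by rewrite EnR; lra.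
move=> /(_ isT); have [En'] : (a + b = n)%N by lia.
move=> /(_ En'); apply: eq_pd => m.
rewrite /partial_ratio addnS !big_ord_recr /=.
by rewrite En' !addrA invfM; ring.
Qed.

(** The last two products run over one progression, so their overlap cancels; the number [a + n] of
    factors left is independent of [b], which prepares the limit in [b]. *)
Lemma partial_ratioE p r a b n : 1 <= p -> -1 < r ->
  partial_ratio p r a b n = binomial_seq p r n * (a + n)`!%:R /
    \prod_(i < a + n) (n%:R * (p - 1) + r + (b + i).+1%:R).
Proof.
move=> p1 r1; pose g i := n%:R * (p - 1) + r + i.+1%:R.
have g0 k (h : nat -> nat) : \prod_(i < k) g (h i) != 0.
  apply/prodf_neq0 => i _; rewrite gt_eqF // /g mulrSr.
  have : 0 <= (h i)%:R :> R by []; have : 0 <= n%:R * (p - 1).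
    by rewrite mulr_ge0 // subr_ge0.
  by lra.
have e : (\prod_(i < n) g i) * \prod_(i < a + b) g (n + i)%N =
         (\prod_(i < b) g i) * \prod_(i < n + a) g (b + i)%N.
  have gD k l : \prod_(i < k + l) g i =
    (\prod_(i < k) g i) * \prod_(i < l) g (k + i)%N by rewrite big_split_ord.
  by rewrite -!gD (_ : n + (a + b) = b + (n + a))%N //; lia.
rewrite /partial_ratio binomial_seqE (addnC a n) natr_fact_addn.
rewrite (eq_bigr (fun i : 'I_(a + b) => g (n + i)%N)) => [|i _]; last first.
  by rewrite /g -addnS natrD; ring.
have f0 : n`!%:R != 0 :> R by rewrite pnatr_eq0 -lt0n fact_gt0.
rewrite -[X in _ * X / _ = _]/(\prod_(i < b) g i).
rewrite (_ : \prod_(i < b) g i = (\prod_(i < n) g i) *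
  \prod_(i < a + b) g (n + i)%N / \prod_(i < n + a) g (b + i)%N); last first.
  by rewrite e mulfK.
have := g0 (a + b)%N (addn n); have := g0 (n + a)%N (addn b).
rewrite -[X in _ = _ / X]/(\prod_(i < n + a) g (b + i)%N).
rewrite -[X in _ = X / _ * _ / _]/(\prod_(i < n) g i).
move: (\prod_(i < a) _) (\prod_(i < n) g i) (\prod_(i < a + b) _)
  (\prod_(i < n + a) _) (n`!%:R) f0 => u v w x y y0 x0 w0.
by field; rewrite x0 w0 y0.
Qed.

Lemma pd_binomial_gt p r : 1 <= p -> -1 < r -> r <= p - 1 ->
  positive_definite (binomial_seq p r).
Proof.
move=> p1 r1 rp.
(* First limit: [b] tends to infinity with [a] fixed, after scaling by [m.+1 ^+ (a + n)]. *)
have pH a : positive_definite (fun n => binomial_seq p r n * (a + n)`!%:R).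
  pose c n i := n%:R * (p - 1) + r + i%:R.
  apply: (@pd_lim _ (fun m n => binomial_seq p r n * (a + n)`!%:R *
      (\prod_(i < a + n) (1 + c n i / m.+1%:R))^-1)) => [m|n].
    have := pd_geom m.+1%:R (pd_partial_ratio a m p1 r1 rp).
    move/(pdZ (exprn_ge0 a (ler0n R m.+1))); apply: eq_pd => n.
    rewrite partial_ratioE // -[LHS]mulrA -exprD (addnC n a) -[LHS]mulrA.
    congr (_ * _); rewrite (eq_bigr (fun i : 'I_(a + n) =>
      m.+1%:R * (1 + c n i / m.+1%:R))) => [|i _].
      rewrite big_split /= prodr_const card_ord invfM mulrC mulrA divff.
        by rewrite mul1r.
      by rewrite expf_neq0 // pnatr_eq0.
    by rewrite /c -addSn natrD; field; rewrite ?nat1r ?natr1 pnatr_eq0.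
  suff : binomial_seq p r n * (a + n)`!%:R *
      (\prod_(i < a + n) (1 + c n i / m.+1%:R))^-1 @[m --> \oo] -->
      binomial_seq p r n * (a + n)`!%:R * 1^-1 by rewrite invr1 mulr1.
  apply: cvgM; first exact: cvg_cst.
  apply: cvgV; first exact: oner_neq0.
  exact: (cvg_prod_shift (a + n) (c n)).
(* Second limit: [a = m.+1] tends to infinity, and [(a + n)!] divided by [a! * a ^+ n] tends to
   1. *)
apply: (@pd_lim _ (fun m n => binomial_seq p r n *
    \prod_(i < n) (1 + i.+1%:R / m.+1%:R))) => [m|n]; last first.
  suff : binomial_seq p r n * \prod_(i < n) (1 + i.+1%:R / m.+1%:R)
      @[m --> \oo] --> binomial_seq p r n * 1 by rewrite mulr1.
  apply: cvgM; first exact: cvg_cst.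
  exact: (cvg_prod_shift n (fun i => i.+1%:R)).
have m0 : 0 <= (m.+1`!%:R : R)^-1 by rewrite invr_ge0.
apply: eq_pd (pdZ m0 (pd_geom (m.+1%:R)^-1 (pH m.+1))) => n.
rewrite natr_fact_addn -!mulrA; congr (_ * _).
rewrite (eq_bigr (fun i : 'I_n => (1 + i.+1%:R / m.+1%:R) * m.+1%:R)) => [|i _].
  rewrite big_split /= prodr_const card_ord exprVn.
  by field; rewrite expf_neq0 ?pnatr_eq0 // -!lt0n !fact_gt0.
by field; rewrite ?nat1r ?natr1 pnatr_eq0.
Qed.

Lemma pd_binomial_ge1 p r : 1 <= p -> -1 <= r -> r <= p - 1 ->
  positive_definite (binomial_seq p r).
Proof.
move=> p1; rewrite le_eqVlt => /orP[/eqP <- _|]; last exact: pd_binomial_gt.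
have p0 : 0 < p by lra.
have c0 : 0 <= (p - 1) / p by rewrite divr_ge0 //; lra.
have d0 : 0 <= p^-1 by rewrite invr_ge0 ltW.
have pb : positive_definite (binomial_seq p 0).
  by apply: pd_binomial_gt => //; lra.
(* For [n > 0], binom(np - 1, n) is (p - 1) / p times binom(np, n); a mass [1 / p] at 0 corrects the
   term [n = 0]. *)
apply: eq_pd (pdD (pdZ c0 pb) (pdZ d0 (@pd_dirac0 R))) => -[|n].
  rewrite /binomial_seq /gbinom !big_ord0 fact0 eqxx mulr1n.
  by field; rewrite gt_eqF.
rewrite mul0r addr0 !binomial_seqE big_ord_recr [in RHS]big_ord_recl /=.
rewrite (eq_bigr (fun i : 'I_n => n.+1%:R * (p - 1) + -1 + (bump 0 i).+1%:R)).
  have : n.+1`!%:R != 0 :> R by rewrite pnatr_eq0 -lt0n fact_gt0.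
  move: (\prod_(i < n) _) (n.+1`!%:R) => u v v0.
  by rewrite mulrSr; field; rewrite v0 gt_eqF.
by move=> i _; rewrite [in RHS]mulrSr /bump add1n; ring.
Qed.

Lemma pd_raney_ge1 p r : 1 <= p -> 0 <= r -> r <= p ->
  positive_definite (raney_seq p r).
Proof.
move=> p1; rewrite le_eqVlt => /orP[/eqP <- _|r0 rp].
  by apply: eq_pd (@pd_dirac0 R) => -[|n] //; rewrite /raney_seq /= !mul0r.
have p10 : 0 <= p - 1 by lra.
have pb : positive_definite (binomial_seq p (r - 1)).
  by apply: pd_binomial_ge1 => //; lra.
apply: eq_pd (pdZ (ltW r0) (pd_div p10 r0 pb)) => n.
rewrite raney_binomial 1?mulrA 1?mulrAC // gt_eqF // ltr_wpDl // mulr_ge0 //.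
Qed.

(** Both parts are [s 1 ^+ 2 <= s 0 * s 2], the second one expanded in [p] and [r]. *)
Lemma binomial_moment2 p r : positive_definite (binomial_seq p r) ->
  (p + r) ^+ 2 <= binomial_seq p r 2 /\ r * (r + 1) <= 2 * p * (p - 1).
Proof.
move=> /(pd_cauchy_schwarz 0 1); rewrite add0n double0.
have -> : binomial_seq p r 0 = 1.
  by rewrite /binomial_seq /gbinom big_ord0 fact0 divr1.
have -> : binomial_seq p r 1 = p + r.
  by rewrite /binomial_seq /gbinom big_ord1 divr1 mul1r subr0.
have -> : binomial_seq p r 1.*2 = (2 * p + r) * (2 * p + r - 1) / 2.
  by rewrite /binomial_seq /gbinom big_ord_recl big_ord1 subr0.
by rewrite mul1r => h; split; lra.
Qed.

Lemma raney_moment2 p r : positive_definite (raney_seq p r) ->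
  r ^+ 2 <= raney_seq p r 2 /\ 0 <= r * (2 * p - 1 - r).
Proof.
move=> /(pd_cauchy_schwarz 0 1); rewrite add0n double0.
have -> : raney_seq p r 1 = r by rewrite /raney_seq /= big_geq // divr1 mulr1.
have -> : raney_seq p r 1.*2 = r / 2 * (2 * p + r - 1).
  by rewrite /raney_seq big_nat1.
by rewrite mul1r => h; split; lra.
Qed.

End BinomialRaney.

(** * Necessity, for [p >= 1] and then for [0 < p <= 1/2] *)

Section Necessity.
Variable R : realType.
Implicit Types (p r x z : R).

Lemma mulr_nat_gt0 p q n : 0 <= p -> 0 < q -> 0 < n%:R * p + q :> R.
Proof. by move=> p0 q0; rewrite ltr_wpDl ?mulr_ge0. Qed.

(** The Beta value is Gamma(n + 2) Gamma(n(p - 1) + r + 1) / Gamma(np + r + 3), which cancels the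
    Gamma quotient up to a rational function. *)
Lemma binomial_beta1 p r n : 1 <= p -> -1 < r ->
  binomial_seq p r n * beta_nat (n + 1) (n%:R * (p - 1) + (r + 1)) =
  (n%:R + 1) / ((n%:R * p + (r + 1)) * (n%:R * p + (r + 2))).
Proof.
move=> p1 r1; have z0 : 0 < n%:R * (p - 1) + (r + 1).
  by rewrite mulr_nat_gt0 //; lra.
have n0 : 0 <= n%:R :> R by [].
rewrite binomial_seqE /beta_nat addn1 factS !big_ord_recr /=.
rewrite (eq_bigr (fun i : 'I_n => n%:R * (p - 1) + (r + 1) + i%:R)); last first.
  by move=> i _; rewrite mulrSr; ring.
have -> : n%:R * (p - 1) + (r + 1) + n.+1%:R = n%:R * p + (r + 2).
  by rewrite mulrSr; ring.
have -> : n%:R * (p - 1) + (r + 1) + n%:R = n%:R * p + (r + 1) by ring.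
have q0 : 0 < n%:R * p + (r + 1) by rewrite mulr_nat_gt0 //; lra.
have q1 : 0 < n%:R * p + (r + 2) by rewrite mulr_nat_gt0 //; lra.
have := prod_shift_gt0 n z0; move: (\prod_(i < n) _) => u u0.
have f0 : n`!%:R != 0 :> R by rewrite pnatr_eq0 -lt0n fact_gt0.
rewrite natrM mulrSr; move: n`!%:R f0 q0 q1 => v v0.
move: (n%:R * p + (r + 1)) (n%:R * p + (r + 2)) => a b a0 b0.
by field; rewrite v0 !gt_eqF.
Qed.

(** A variant for [r < -1]: positivity is asked at the given [n] only, as it then holds just for
    large [n]. *)
Lemma binomial_beta0 p r n :
  0 < n%:R * (p - 1) + (r + 2) -> 0 < n%:R * p + (r + 1) ->
  binomial_seq p r n * beta_nat n (n%:R * (p - 1) + (r + 2)) =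
  (n%:R * (p - 1) + (r + 1)) / ((n%:R * p + (r + 1)) * (n%:R * p + (r + 2))).
Proof.
move=> z0 q0; have q1 : 0 < n%:R * p + (r + 2) by lra.
rewrite binomial_seqE /beta_nat big_ord_recr /=.
have -> : n%:R * (p - 1) + (r + 2) + n%:R = n%:R * p + (r + 2) by ring.
have e : (\prod_(i < n) (n%:R * (p - 1) + r + i.+1%:R)) * (n%:R * p + (r + 1)) =
  (n%:R * (p - 1) + (r + 1)) * \prod_(i < n) (n%:R * (p - 1) + (r + 2) + i%:R).
  transitivity (\prod_(i < n.+1) (n%:R * (p - 1) + r + i.+1%:R)).
    by rewrite big_ord_recr /=; congr (_ * _); rewrite mulrSr; ring.
  rewrite big_ord_recl; congr (_ * _); first by rewrite /=; ring.
  by apply: eq_bigr => i _; rewrite /= /bump add1n 2!mulrSr; ring.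
have := prod_shift_gt0 n z0; move/(canRL (mulfK (lt0r_neq0 q0))) : e => ->.
move: (\prod_(i < n) _) => u u0.
have f0 : n`!%:R != 0 :> R by rewrite pnatr_eq0 -lt0n fact_gt0.
move: n`!%:R f0 q0 q1 => v v0.
move: (n%:R * p + (r + 1)) (n%:R * p + (r + 2)) => a b a0 b0.
by field; rewrite v0 !gt_eqF.
Qed.

Lemma pd_binomial_ge1_le p r : 1 <= p -> positive_definite (binomial_seq p r) ->
  r <= p - 1.
Proof.
move=> p1 ps; rewrite leNgt; apply/negP => rp.
have q0 : 0 < r + 1 by lra.
have p0 : 0 < p by lra.
have p10 : 0 <= p - 1 by lra.
apply: (@not_pd_cubic _ 1 1 p (r + 1)) => //; first by lra.
have h : p * (r + 1) <= (r + 2) * p by lra.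
(* The homographic factor trades [n p + r + 2] for [n p + r + 1]; the division completes the
   cube. *)
apply: eq_pd (pd_div (ltW p0) q0
  (pd_homographic (ltW p0) p0 q0 h (pd_beta 1 p10 q0 ps))) => n.
rewrite binomial_beta1 //; last by lra.
have a0 := mulr_nat_gt0 n (ltW p0) q0.
have b0 : 0 < n%:R * p + (r + 2) by apply: mulr_nat_gt0; lra.
move: a0 b0; move: (n%:R * p + (r + 1)) (n%:R * p + (r + 2)) => a b a0 b0.
by field; rewrite !gt_eqF.
Qed.

(* For r < -1 the Gamma quotient has a pole at n = -(r + 1) / p > 0; shifting
   the sequence by 2k moves it to the left of 0. *)
Lemma pd_binomial_ge1_ge p r : 1 <= p -> positive_definite (binomial_seq p r) ->
  -1 <= r.
Proof.
move=> p1 ps; rewrite leNgt; apply/negP => r1.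
have [_ m2] := binomial_moment2 ps.
(* At [p = 1] the second moment would give [r * (r + 1) <= 0], false for [r < -1]. *)
have {}p1 : 1 < p by rewrite lt_neqAle p1 andbT; apply/eqP => pE; nra.
have p0 : 0 < p by lra.
have p10 : 0 < p - 1 by lra.
have [k kp] : exists k, - (r + 1) < k.*2%:R * (p - 1).
  exists (Num.truncn (- (r + 1) / (p - 1))).+1.
  have := truncnS_gt (- (r + 1) / (p - 1)); rewrite ltr_pdivrMr // -muln2 natrM.
  by move: (Num.truncn _) => t h; apply: lt_le_trans h _; rewrite ler_pM2r //;
    have : 0 <= t.+1%:R :> R by []; lra.
have k0 : 0 <= k.*2%:R :> R by [].
pose q := k.*2%:R * p + (r + 1).
have q0 : 0 < q by rewrite /q; lra.
have y0 : 0 < k.*2%:R * (p - 1) + (r + 2) by lra.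
apply: (@not_pd_cubic _ (p - 1) (k.*2%:R * (p - 1) + (r + 1)) p q) => //.
  by rewrite /q; nra.
have h : p * q <= (q + 1) * p by lra.
apply: eq_pd (pd_div (ltW p0) q0 (pd_homographic (ltW p0) p0 q0 h
  (pd_beta k.*2 (ltW p10) y0 (pd_shift k ps)))) => n.
have zE : n%:R * (p - 1) + (k.*2%:R * (p - 1) + (r + 2)) =
    (n + k.*2)%:R * (p - 1) + (r + 2) by rewrite natrD; ring.
have qE : n%:R * p + q = (n + k.*2)%:R * p + (r + 1) by rewrite natrD /q; ring.
have a0 := mulr_nat_gt0 n (ltW p0) q0.
rewrite zE binomial_beta0 -?zE -?qE //; last by rewrite mulr_nat_gt0 // ltW.
have -> : (n + k.*2)%:R * p + (r + 2) = n%:R * p + (q + 1).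
  by rewrite natrD /q; ring.
have -> : (n + k.*2)%:R * (p - 1) + (r + 1) =
  n%:R * (p - 1) + (k.*2%:R * (p - 1) + (r + 1)) by rewrite natrD; ring.
have b0 : 0 < n%:R * p + (q + 1) by lra.
move: a0 b0; move: (n%:R * p + q) (n%:R * p + (q + 1)) => a b a0 b0.
by field; rewrite !gt_eqF.
Qed.

Lemma pd_raney_ge1_le p r : 1 <= p -> positive_definite (raney_seq p r) ->
  0 <= r <= p.
Proof.
move=> p1 ps; have [_ m2] := raney_moment2 ps.
have r0 : 0 <= r by rewrite leNgt; apply/negP => r0; nra.
rewrite r0 /= leNgt; apply/negP => rp.
have {}r0 : 0 < r by lra.
have p0 : 0 < p by lra.
have p10 : 0 <= p - 1 by lra.
apply: (@not_pd_cubic _ 1 1 p r) => //; first by lra.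
have h1 : p * r <= (r + 1) * p by lra.
have h2 : (p - 1) * r <= r * p by lra.
have ri : 0 <= r^-1 by rewrite invr_ge0 ltW.
(* One homographic factor trades [n p + r + 1] for [n p + r], the other does so for the Raney
   denominator [n (p - 1) + r]. *)
apply: eq_pd (pdZ ri (pd_homographic p10 p0 r0 h2
  (pd_homographic (ltW p0) p0 r0 h1 (pd_beta 1 p10 r0 ps)))) => n.
have c0 := mulr_nat_gt0 n p10 r0.
rewrite raney_binomial ?gt_eqF // (mulrAC (binomial_seq p (r - 1) n)).
have := @binomial_beta1 p (r - 1) n p1; rewrite subrK => ->; last by lra.
rewrite (_ : r - 1 + 2 = r + 1); last by ring.
have a0 := mulr_nat_gt0 n (ltW p0) r0.
have b0 : 0 < n%:R * p + (r + 1) by apply: mulr_nat_gt0; lra.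
move: a0 b0 c0; move: (n%:R * p + r) (n%:R * p + (r + 1)) (n%:R * (p - 1) + r).
by move=> a b c a0 b0 c0; field; rewrite !gt_eqF.
Qed.

(** Exactly the [N - M.+1] factors with [i > M] are taken as nonpositive. The start [l] is 0 for
    binomial terms and 1 for Raney terms. *)
Lemma prod_sub_sign x l M N : (l <= M.+1)%N -> (M < N)%N ->
  M%:R <= x <= M.+1%:R ->
  0 <= (-1) ^+ (N - M.+1) * \prod_(l <= i < N) (x - i%:R).
Proof.
move=> lM MN /andP[Mx xM]; rewrite (@big_cat_nat _ _ _ M.+1) //= mulrCA.
apply: mulr_ge0.
  rewrite big_nat_cond; apply: prodr_ge0 => i /andP[/andP[_ iM] _].
  by rewrite subr_ge0 (le_trans _ Mx) // ler_nat -ltnS.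
rewrite -(prodr_const_nat M.+1 N) -big_split /= big_nat_cond.
apply: prodr_ge0 => i /andP[/andP[Mi _] _].
by rewrite mulN1r opprB subr_ge0 (le_trans xM) // ler_nat.
Qed.

(* The sequence 2np + r is unbounded and has steps 2p <= 1, so it visits every
   interval [M, M + 1] with M > r. *)
Lemma exists_floor_parity p r (b : bool) : 0 < p -> p <= 2^-1 ->
  exists n M, [/\ (0 < n)%N, (M < n.*2)%N, odd M = b &
                  M%:R <= n.*2%:R * p + r <= M.+1%:R].
Proof.
move=> p0 p1; pose k := (Num.truncn (2 * `|r| + 1)).+1.
pose M := (b + k.*2)%N.
(* This yields [M < n.*2]: from [M <= n.*2 * p + r <= n + r] follows [n.*2 >= 2 * (M - r) > M]. *)
have Mr : 2 * `|r| + 1 < M%:R.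
  by apply: lt_le_trans (truncnS_gt _) _; rewrite ler_nat /M -/k; lia.
have ex : exists n, M%:R <= n.*2%:R * p + r.
  exists (Num.truncn ((M%:R - r) / p)).+1.
  have := truncnS_gt ((M%:R - r) / p); rewrite ltr_pdivrMr //.
  move: (Num.truncn _).+1 => t; rewrite -muln2 natrM.
  have : 0 <= t%:R * p by rewrite mulr_ge0 // ltW.
  lra.
have rr : - `|r| <= r <= `|r| by rewrite -ler_norml.
have := ex_minnP ex; move=> [n nM nmin].
have n0 : (0 < n)%N.
  by rewrite lt0n; apply/eqP => n0; move: nM; rewrite n0 mul0r; lra.
have nlt : n.*2%:R * p + r < M%:R + 1.
  case: n n0 nM nmin => // n _ nM nmin.
  rewrite ltNge; apply/negP => h; suff : (n.+1 <= n)%N by rewrite ltnn.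
  by apply: nmin; move: h; rewrite doubleS -addn2 natrD; lra.
exists n, M; split=> //.
- rewrite -(ltr_nat R).
  have : n.*2%:R * p <= n.*2%:R * 2^-1 by rewrite ler_wpM2l.
  lra.
- by rewrite /M oddD odd_double addbF; case: (b).
- by rewrite nM /= mulrSr ltW.
Qed.

Lemma not_pd_binomial_half p r : 0 < p -> p <= 2^-1 ->
  ~ positive_definite (binomial_seq p r).
Proof.
move=> p0 p1 ps; have [s2 m2] := binomial_moment2 ps.
(* If [p + r = 0], then [m2] reads [p * (p - 1) <= 2 * p * (p - 1)], impossible for [0 < p < 1]. *)
have {}s2 : 0 < binomial_seq p r 2.
  apply: lt_le_trans s2; rewrite lt_def sqr_ge0 andbT sqrf_eq0.
  by apply/eqP => /(canRL (addKr p)) rE; move: m2; rewrite rE; nra.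
(* An even [M] leaves an odd number [n.*2 - M.+1] of nonpositive factors. *)
have [n [M [n0 Mn oM Mx]]] := @exists_floor_parity p r false p0 p1.
have := pd_even_gt0 ps s2 n0; have := @prod_sub_sign _ 0 _ _ isT Mn Mx.
rewrite -signr_odd oddB // odd_double /= oM expr1 mulN1r oppr_ge0 big_mkord.
rewrite /binomial_seq /gbinom => le0; apply/negP; rewrite -leNgt.
by rewrite pmulr_lle0 // invr_gt0 ltr0n fact_gt0.
Qed.

Lemma pd_raney_half p r : 0 < p -> p <= 2^-1 ->
  positive_definite (raney_seq p r) -> r = 0.
Proof.
move=> p0 p1 ps; have [s2 _] := raney_moment2 ps.
apply/eqP; apply: contraT => rn0.
have {}s2 : 0 < raney_seq p r 2.
  by apply: lt_le_trans s2; rewrite lt_def sqr_ge0 sqrf_eq0 rn0.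
(* The parity of [M] is chosen so that the product has the sign opposite to that of [r], or
   vanishes. *)
have [n [M [n0 Mn oM Mx]]] := @exists_floor_parity p r (r < 0) p0 p1.
have := pd_even_gt0 ps s2 n0; have := @prod_sub_sign _ 1 _ _ isT Mn Mx.
rewrite -signr_odd oddB // odd_double /= oM /raney_seq double_eq0 gtn_eqF //.
set P := \prod_(_ <= _ < _) _ => sP; rewrite ltNge => /negP[].
rewrite mulrAC pmulr_lle0 ?invr_gt0 ?ltr0n ?fact_gt0 //.
move: sP; case: ltgtP rn0 => //= r0 _; rewrite ?expr0 ?expr1; nra.
Qed.

End Necessity.

Theorem theorem7p2 (R : realType) (p r : R) :
  (positive_definite (binomial_seq p r) <->
     (1 <= p /\ -1 <= r /\ r <= p - 1) \/ (p <= 0 /\ p - 1 <= r /\ r <= 0))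
  /\
  (positive_definite (raney_seq p r) <->
     (1 <= p /\ 0 <= r /\ r <= p) \/ (p <= 0 /\ p - 1 <= r /\ r <= 0) \/ r = 0).
Proof.
have pI : 1 - (1 - p) = p by lra.
have rI : -1 - (-1 - r) = r by lra.
(* The reflection [p -> 1 - p] exchanges the first two ranges and the last two. *)
have p3 : [\/ 1 <= p, p <= 0, 0 < p <= 2^-1 | 0 < 1 - p <= 2^-1].
  have [h|h] := lerP 1 p; first by constructor 1.
  have [h'|h'] := lerP p 0; first by constructor 2.
  by have [?|?] := lerP p 2^-1; [constructor 3|constructor 4]; lra.
split; split.
- move=> ps; have ps' := pd_binomial_reflect ps.
  case: p3 => [p1|p0|/andP[p0 ph]|/andP[p0 ph]].
  + left; split=> //; split; first exact: pd_binomial_ge1_ge ps.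
    exact: pd_binomial_ge1_le ps.
  + have p1 : 1 <= 1 - p by lra.
    have := pd_binomial_ge1_ge p1 ps'; have := pd_binomial_ge1_le p1 ps'.
    by right; split=> //; split; lra.
  + by case: (not_pd_binomial_half p0 ph ps).
  + by case: (not_pd_binomial_half p0 ph ps').
- case=> -[p1 [r1 r2]]; first exact: pd_binomial_ge1.
  have : positive_definite (binomial_seq (1 - p) (-1 - r)).
    by apply: pd_binomial_ge1; lra.
  by move/pd_binomial_reflect; rewrite pI rI.
- move=> ps; have ps' := pd_raney_reflect ps.
  case: p3 => [p1|p0|/andP[p0 ph]|/andP[p0 ph]].
  + by left; split=> //; apply/andP; exact: pd_raney_ge1_le ps.
  + have p1 : 1 <= 1 - p by lra.
    have /andP[? ?] := pd_raney_ge1_le p1 ps'.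
    by right; left; split=> //; split; lra.
  + by right; right; exact: pd_raney_half ps.
  + by right; right; apply: oppr_inj; rewrite oppr0; exact: pd_raney_half ps'.
- case=> [[p1 [r1 r2]]|[[p1 [r1 r2]]|->]]; first exact: pd_raney_ge1.
    have : positive_definite (raney_seq (1 - p) (- r)).
      by apply: pd_raney_ge1; lra.
    by move/pd_raney_reflect; rewrite pI opprK.
  by apply: eq_pd (@pd_dirac0 R) => -[|n] //; rewrite /raney_seq /= !mul0r.
Qed.
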